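(* Let $R$ be a tolerance on $U$. Then the following are equivalent: (a) $\mathit{RS}_X$ is a complete lattice for all $X\subseteq U$. (b) $\mathit{RS}_X$ is a lattice for all $X\subseteq U$ with $|X|=5$. (c) For any $X\subseteq U$, ${R_X}^3$ is an equivalence on $X$.
   Context: A tolerance on a set is a reflexive and symmetric binary relation. For $X\subseteq U$, $R_X=R\cap(X\times X)$ is the restriction of $R$ to $X$ (a tolerance on $X$), and ${R_X}^3=R_X\circ R_X\circ R_X$ is the relational composition. For a tolerance $Q$ on a set $V$, put $Q(x)=\{y\in V\mid x\,Q\,y\}$ and, for $Z\subseteq V$, let the lower approximation be $Z^{\blacktriangledown}=\{x\in V\mid Q(x)\subseteq Z\}$ and the upper approximation $Z^{\blacktriangle}=\{x\in V\mid Q(x)\cap Z\neq\emptyset\}$. The ordered set of rough sets determined by $Q$ on $V$ is $\{(Z^{\blacktriangledown},Z^{\blacktriangle})\mid Z\subseteq V\}$, ordered coordinatewise by inclusion. $\mathit{RS}_X$ denotes the ordered set of rough sets determined by $R_X$ on $X$. *)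

(* Defs.v *)
From HB Require Import structures.
From mathcomp Require Export all_boot all_order.
From mathcomp Require Export boolp classical_sets functions cardinality.

Set Implicit Arguments.
Unset Strict Implicit.
Unset Printing Implicit Defensive.

Import Order.TTheory.
Local Open Scope classical_set_scope.

(* A relation on a subset V of U is a set of pairs included in V `*` V. *)

Definition tolerance_on (U : Type) (V : set U) (Q : set (U * U)) : Prop :=
  [/\ Q `<=` V `*` V,
      forall x, V x -> Q (x, x) &
      forall x y, Q (x, y) -> Q (y, x)].

Definition equivalence_on (U : Type) (V : set U) (Q : set (U * U)) : Prop :=
  [/\ Q `<=` V `*` V,
      forall x, V x -> Q (x, x),
      forall x y, Q (x, y) -> Q (y, x) &
      forall x y z, Q (x, y) -> Q (y, z) -> Q (x, z)].

Definition restr (U : Type) (R : set (U * U)) (X : set U) : set (U * U) :=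
  R `&` (X `*` X).

Definition rel_cube (U : Type) (Q : set (U * U)) : set (U * U) :=
  (Q \; Q \; Q)%relation.

Section RoughSets.
Variables (U : Type) (V : set U) (Q : set (U * U)).

Definition nbhd (x : U) : set U := [set y | V y /\ Q (x, y)].

Definition lower_approx (Z : set U) : set U := [set x | V x /\ nbhd x `<=` Z].

Definition upper_approx (Z : set U) : set U :=
  [set x | V x /\ nbhd x `&` Z !=set0].

(* [*p] is the cartesian product with the coordinatewise order; the order on
   [set U] is inclusion. *)
Definition rough_sets : set (set U *p set U) :=
  [set p | exists2 Z : set U,
             Z `<=` V & p = (lower_approx Z, upper_approx Z)].

Definition RS : Type := set_type rough_sets.

HB.instance Definition _ := SubChoice.on RS.
HB.instance Definition _ :=
  [SubChoice_isSubPOrder of RS by <: with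
     Order.prod_display set_display set_display].

End RoughSets.

Definition is_lattice (d : Order.disp_t) (T : porderType d) : Prop :=
  forall x y : T,
    supremums [set x; y] !=set0 /\ infimums [set x; y] !=set0.

Definition is_complete_lattice (d : Order.disp_t) (T : porderType d) : Prop :=
  forall A : set T, supremums A !=set0 /\ infimums A !=set0.

(* Main.v *)
(** Let a family of rough sets be given by sets [Z], let [T] be the union of
    their upper approximations and [L] the union of the upper approximations of
    their lower approximations. Its supremum exists as soon as some [W] has upper
    approximation [T] and the same lower approximation as [L]. Such a [W] lies
    between [L] and the lower approximation of [T], so one has to choose which
    points of the difference [B] go into [W]: every point of [T] not adjacent to
    [L] needs a neighbour inside [W], and every point whose neighbourhood lies in
    the lower approximation of [T] but not in [L] needs one outside [W]. A point of
    [B] that is the neighbour of a point of [L] with the second requirement and of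
    a point outside the lower approximation of [T] with the first would be the
    middle of an induced path on five vertices; without such paths all choices
    are forced or free except on a set where a maximal independent set does the
    job. Conversely, on an induced path with five vertices the rough sets do not
    form a lattice, and the absence of such paths means that every walk of length
    four has a shortcut, i.e. that the cube of the relation is transitive. *)

Require Import Defs.
Local Open Scope classical_set_scope.
Local Open Scope card_scope.

Set Implicit Arguments.
Unset Strict Implicit.

Definition induced_P5 (U : Type) (Q : set (U * U)) (a b c d e : U) : Prop :=
  [/\ Q (a, b), Q (b, c), Q (c, d) & Q (d, e)] /\
  ([/\ ~ Q (a, c), ~ Q (a, d) & ~ Q (a, e)] /\
   [/\ ~ Q (b, d), ~ Q (b, e) & ~ Q (c, e)]).

Definition P5_free (U : Type) (Q : set (U * U)) : Prop :=
  forall a b c d e, ~ induced_P5 Q a b c d e.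

Lemma supremums_complete (d : Order.disp_t) (T : porderType d) :
  (forall A : set T, supremums A !=set0) -> is_complete_lattice T.
Proof.
move=> sup A; split=> //.
have [s [ub_s lub_s]] := sup (lbound A).
exists s; split=> [x Ax|x]; last exact: ub_s.
by apply: lub_s => y; apply.
Qed.

(** Zorn's lemma gives an independent set maximal for inclusion; a point of [D] with no neighbour in
    it could still be added. *)
Lemma maximal_independent (U : Type) (Q : set (U * U)) (D : set U) :
  (forall x, D x -> Q (x, x)) -> (forall x y, Q (x, y) -> Q (y, x)) ->
  exists2 I : set U, I `<=` D &
    (forall x y, I x -> I y -> Q (x, y) -> x = y) /\
    (forall x, D x -> exists2 y, I y & Q (x, y)).
Proof.
move=> Qr Qs.
pose P (I : set U) :=
  I `<=` D /\ forall x y, I x -> I y -> Q (x, y) -> x = y.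
have [|I [[ID Iind] Imax]] := @Zorn_bigcup U P.
  move=> F FP Ftot; split=> [x [A FA Ax]|x y [A FA Ax] [B FB By]].
    exact: (FP _ FA).1 Ax.
  have [AB|BA] := Ftot _ _ FA FB.
    by apply: (FP _ FB).2 => //; apply: AB.
  by apply: (FP _ FA).2 => //; apply: BA.
exists I => //; split=> // x Dx.
apply: contrapT => nx.
have nQ y : I y -> ~ Q (x, y) by move=> Iy Qxy; apply: nx; exists y.
apply: (Imax (I `|` [set x])).
  split=> [y Iy|sub]; first by left.
  by apply: (nQ x); [apply: sub; right|exact: Qr].
split=> [y [/ID//|->//]|y z [Iy|->] [Iz|->]//].
- exact: Iind.
- by move/Qs/(nQ _ Iy).
- by move/(nQ _ Iz).
Qed.

(** * Approximations and suprema of rough sets *)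

Section RoughSetOrder.
Variables (U : Type) (V : set U) (Q : set (U * U)).
Hypothesis hQ : tolerance_on V Q.

Local Notation lo := (lower_approx V Q).
Local Notation up := (upper_approx V Q).

Let Q_dom x y : Q (x, y) -> V x /\ V y.
Proof. by have [QV _ _] := hQ; move=> /QV[]. Qed.

Let Q_refl x : V x -> Q (x, x).
Proof. by have [_ + _] := hQ; apply. Qed.

Let Q_sym x y : Q (x, y) -> Q (y, x).
Proof. by have [_ _ +] := hQ; apply. Qed.

Lemma RS_le (p q : RS V Q) :
  (p <= q)%O <-> (val p).1 `<=` (val q).1 /\ (val p).2 `<=` (val q).2.
Proof.
rewrite -Order.le_val Order.ProdOrder.leEprod -!subsetEset.
by split=> [/andP//|[-> ->]].
Qed.

Lemma RS_of_set (Z : set U) :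
  Z `<=` V -> exists p : RS V Q, val p = (lo Z, up Z).
Proof.
move=> ZV; have h : rough_sets V Q (lo Z, up Z) by exists Z.
by exists (SigSub (mem_set h)).
Qed.

Lemma RS_rep (p : RS V Q) : exists2 Z, Z `<=` V & val p = (lo Z, up Z).
Proof. exact: (set_mem (valP p)). Qed.

Lemma upP (Z : set U) x : up Z x <-> exists2 y, Z y & Q (x, y).
Proof.
split=> [[_ [y [[_ Qxy] Zy]]]|[y Zy Qxy]]; first by exists y.
by have [Vx Vy] := Q_dom Qxy; split=> //; exists y.
Qed.

Lemma loP (Z : set U) x : lo Z x <-> V x /\ forall y, Q (x, y) -> Z y.
Proof.
split=> [[Vx sub]|[Vx sub]]; split=> // y; last by case=> _; apply: sub.
by move=> Qxy; apply: sub; split=> //; have [] := Q_dom Qxy.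
Qed.

Lemma lo_sub (Z : set U) : lo Z `<=` Z.
Proof. by move=> x /loP[Vx]; apply; apply: Q_refl. Qed.

Lemma loS (Y Z : set U) : Y `<=` Z -> lo Y `<=` lo Z.
Proof. by move=> YZ x /loP[Vx h]; apply/loP; split=> // y /h/YZ. Qed.

Lemma upS (Y Z : set U) : Y `<=` Z -> up Y `<=` up Z.
Proof. by move=> YZ x /upP[y /YZ Zy Qxy]; apply/upP; exists y. Qed.

Lemma up_lo_sub (Y Z : set U) : Y `<=` lo Z -> up Y `<=` Z.
Proof. by move=> YZ x /upP[y /YZ/loP[_ h] /Q_sym/h]. Qed.

Lemma sub_lo_up (Z : set U) : Z `<=` V -> Z `<=` lo (up Z).
Proof.
move=> ZV x Zx; apply/loP; split; first exact: ZV.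
by move=> y Qxy; apply/upP; exists x => //; apply: Q_sym.
Qed.

Lemma rough_interpolant (F : set (set U)) :
  P5_free Q -> (forall Z, F Z -> Z `<=` V) ->
  exists2 W, W `<=` V &
    up W = up (\bigcup_(Z in F) Z) /\
    lo W = lo (up (\bigcup_(Z in F) lo Z)).
Proof.
move=> noP5 FV.
set S := \bigcup_(Z in F) Z; set M := \bigcup_(Z in F) lo Z.
pose T := up S; pose L := up M.
have SV : S `<=` V by move=> x [Z /FV ZV /ZV].
have ST : S `<=` lo T by exact: sub_lo_up.
have ML : M `<=` L.
  by move=> x Mx; apply/upP; exists x => //; case: Mx => Z _ [Vx _]; exact: Q_refl.
have LT : L `<=` lo T.
  move=> x /upP[y [Z FZ loZy] Qxy]; apply: ST; exists Z => //.
  by have [_] := (loP Z y).1 loZy; apply; exact: Q_sym.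
pose B := lo T `\` L.
(* Points needing a neighbour outside, resp. inside, [W]. *)
pose Out : set U := [set x | [/\ V x, forall y, Q (x, y) -> lo T y & ~ lo L x]].
pose In : set U := [set x | T x /\ forall y, Q (x, y) -> ~ L y].
(* Points that are safe to put into [W]: they do not need a neighbour outside it themselves, and no
   point of [L] that does is adjacent to them. *)
pose C : set U := [set b | [/\ B b, ~ Out b &
  forall x, L x -> Out x -> ~ Q (x, b)]].
(* The ends of the forbidden path are [m] in [M] next to [x], whose neighbours all lie in [L], and
   [u] next to [t] outside [T]. *)
have conflict x b t :
  L x -> Out x -> Q (x, b) -> B b -> Q (b, t) -> In t -> lo T t.
  move=> Lx [Vx xT _] Qxb [loTb nLb] Qbt [Tt tL]; apply: contrapT => nlot.
  have [m Mm Qxm] := (upP M x).1 Lx.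
  have [u Qtu nTu] : exists2 u, Q (t, u) & ~ T u.
    apply: contrapT => nu; apply: nlot; apply/loP.
    split=> [|u Qtu]; first by have [] := Q_dom Qbt.
    by apply: contrapT => nTu; apply: nu; exists u.
  have nL y : Q (m, y) -> L y by move=> Qmy; apply/upP; exists m => //; exact: Q_sym.
  have loT y z : lo T y -> Q (y, z) -> T z by move=> /loP[_]; apply.
  apply: (noP5 m x b t u); split; first by split=> //; exact: Q_sym.
  split; split.
  - by move/nL.
  - by move/nL; apply: tL; apply: Q_refl; have [] := Q_dom Qbt.
  - by move/nL/LT/lo_sub.
  - by move=> /Q_sym/tL.
  - by move/(loT _ _ (LT _ Lx)).
  - by move/(loT _ _ loTb).
(* Points with both requirements and no neighbour in [C]. Maximality of [I] gives each of them a
   neighbour in [W]; a point of [I] has no neighbour in [W] but itself. *)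
pose D : set U := [set b | [/\ B b, Out b, In b & forall c, C c -> ~ Q (b, c)]].
have [|I ID [Iind Imax]] := maximal_independent (Q := Q) (D := D) _ Q_sym.
  by move=> x [[[Vx _] _] _ _ _]; exact: Q_refl.
pose W := L `|` (C `|` I).
have WT : W `<=` lo T by move=> x [/LT//|[[[]]//|/ID[[]]]].
exists W; first by move=> x /WT[].
split; apply/seteqP; split.
- exact: up_lo_sub.
- move=> t Tt; apply: contrapT => nupW.
  have Vt : V t by case: Tt.
  have nW y : Q (t, y) -> ~ W y by move=> Qty Wy; apply: nupW; apply/upP; exists y.
  have Int : In t by split=> // y /nW nWy Ly; apply: nWy; left.
  have [loTt|nloTt] := pselect (lo T t).
    have Bt : B t by split=> // Lt; apply: (nW t); [exact: Q_refl|left].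
    have [Outt|nOutt] := pselect (Out t).
      have Dt : D t by split=> // c Cc /nW; apply; right; left.
      by have [y Iy /nW] := Imax _ Dt; apply; right; right.
    apply: (nW t); first exact: Q_refl.
    right; left; split=> // x Lx _ /Q_sym/nW; apply; left; exact: Lx.
  (* Since [t] is outside [lo T], its neighbour [z] is not in [Out], and [conflict] shows that no
     point of [L] blocks it; so [z] is in [C]. *)
  have [z Sz Qtz] := (upP S t).1 Tt.
  have Bz : B z by split; [exact: ST|move=> Lz; apply: (nW z) => //; left].
  apply: (nW z) => //; right; left; split=> //.
    by case=> _ + _ => /(_ t (Q_sym Qtz)).
  move=> x Lx Outx Qxz; apply: nloTt.
  apply: (conflict x z t) => //; exact: Q_sym.
- move=> x /loP[Vx xW]; apply: contrapT => nloLx.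
  have Outx : Out x by split=> // y /xW/WT.
  have Wx : W x by apply: xW; exact: Q_refl.
  case: (Wx) => [Lx|[[_ +]|Ix]] //.
    have [b Qxb nLb] : exists2 b, Q (x, b) & ~ L b.
      apply: contrapT => nb; apply: nloLx; apply/loP; split=> // b Qxb.
      by apply: contrapT => nLb; apply: nb; exists b.
    have [//|[[_ _ +]|/ID[_ _ [_ +] _]]] := xW _ Qxb.
      by move=> /(_ x Lx Outx).
    by move=> /(_ x (Q_sym Qxb)).
  have [_ _ [Tx xL] xC] := ID _ Ix.
  (* With all its neighbours in [W], [x] is isolated; then any [Z] of the family containing [x] has
     it in [lo Z], which puts it in [L]. *)
  have isolated y : Q (x, y) -> x = y.
    move=> Qxy; have [/(xL _ Qxy)//|[Cy|Iy]] := xW _ Qxy.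
      by have := xC _ Cy.
    exact: Iind.
  have [y [Z FZ Zy] Qxy] := (upP S x).1 Tx.
  apply: (xL x); first exact: Q_refl.
  apply: ML; exists Z => //; apply/loP; split=> // z /isolated <-.
  by rewrite (isolated _ Qxy).
- by apply: loS => x Lx; left.
Qed.

Lemma P5_free_complete : P5_free Q -> is_complete_lattice (RS V Q).
Proof.
move=> noP5; apply: supremums_complete => A.
pose F : set (set U) :=
  [set Z | Z `<=` V /\ exists2 p : RS V Q, A p & val p = (lo Z, up Z)].
have FV Z : F Z -> Z `<=` V by case.
have [W WV [upW loW]] := rough_interpolant noP5 FV.
have [w wE] := RS_of_set WV.
exists w; split=> [p Ap|q ubq]; apply/RS_le; rewrite wE /= upW loW.
  have [Z ZV pE] := RS_rep p; rewrite pE /=.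
  have FZ : F Z by split=> //; exists p.
  split; last by apply: upS => x Zx; exists Z.
  apply: subset_trans (sub_lo_up _) _; first by move=> x [].
  by apply: loS; apply: upS => x loZx; exists Z.
have [Y YV qE] := RS_rep q; rewrite qE /=.
have bnd Z : F Z -> lo Z `<=` lo Y /\ up Z `<=` up Y.
  by case=> _ [p /ubq/RS_le]; rewrite qE => + pE; rewrite pE.
(* If [Y] represents an upper bound, every [lo Z] lies in [lo Y], so the upper approximation of
   their union lies in [Y]. *)
split.
  by apply: loS; apply: up_lo_sub => x [Z /bnd[+ _]]; apply.
move=> x /upP[y [Z FZ Zy] Qxy].
by apply: (bnd _ FZ).2; apply/upP; exists y.
Qed.

(* On the path [a - b - c - d - e] the rough sets of [{a, b}] and [{c}] have no
   supremum: a representative [Z] of it contains [a] and [b], cannot contain [d]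
   or [e] because of the upper bound given by [{a, b, c}], and then needs [c],
   which puts [b] in its lower approximation; but [{a, b, d}] gives an upper
   bound whose lower approximation does not contain [b]. *)
Lemma induced_P5_not_lattice (a b c d e : U) :
  V = [set a; b; c; d; e] -> induced_P5 Q a b c d e ->
  ~ is_lattice (RS V Q).
Proof.
move=> VE [[Qab Qbc Qcd Qde] [[nac nad nae] [nbd nbe nce]]] lat.
have [Va Vb] := Q_dom Qab; have [Vc Vd] := Q_dom Qcd; have [_ Ve] := Q_dom Qde.
have Vcases y : V y -> [\/ y = a, y = b | [\/ y = c, y = d | y = e]].
  rewrite VE => -[[[[]|]|]|] /= ->.
  - by constructor 1.
  - by constructor 2.
  - by constructor 3; constructor 1.
  - by constructor 3; constructor 2.
  - by constructor 3; constructor 3.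
have Zab_V : [set a; b] `<=` V by move=> y [] ->.
have Zc_V : [set c] `<=` V by move=> y ->.
have Zabc_V : [set a; b; c] `<=` V by move=> y [[]|] ->.
have Zabd_V : [set a; b; d] `<=` V by move=> y [[]|] ->.
have [p1 p1E] := RS_of_set Zab_V; have [p2 p2E] := RS_of_set Zc_V.
have [p3 p3E] := RS_of_set Zabc_V; have [p4 p4E] := RS_of_set Zabd_V.
have [[s [ub_s lub_s]] _] := lat p1 p2.
have [Z ZV sE] := RS_rep s.
have [le1 _] : lo [set a; b] `<=` lo Z /\ up [set a; b] `<=` up Z.
  by have /RS_le := ub_s p1 (or_introl erefl); rewrite p1E sE.
have [_ le2] : lo [set c] `<=` lo Z /\ up [set c] `<=` up Z.
  by have /RS_le := ub_s p2 (or_intror erefl); rewrite p2E sE.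
have [_ le3] : lo Z `<=` lo [set a; b; c] /\ up Z `<=` up [set a; b; c].
  suff /lub_s/RS_le : ubound [set p1; p2] p3 by rewrite p3E sE.
  move=> q [] ->; apply/RS_le; rewrite ?p1E ?p2E p3E /=.
    by split; [apply: loS|apply: upS] => y ?; left.
  by split; [apply: loS|apply: upS] => y ?; right.
have [le4 _] : lo Z `<=` lo [set a; b; d] /\ up Z `<=` up [set a; b; d].
  suff /lub_s/RS_le : ubound [set p1; p2] p4 by rewrite p4E sE.
  move=> q [] ->; apply/RS_le; rewrite ?p1E ?p2E p4E /=.
    by split; [apply: loS|apply: upS] => y ?; left.
  (* [{c}] is not a subset of [{a, b, d}], so monotonicity does not apply; but [lo {c}] is empty,
     and [b], [c], [d] all have a neighbour in [{a, b, d}]. *)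
  split=> y.
    move=> yc; have yE : y = c := lo_sub yc.
    move: yc => /loP[_ /(_ b)]; rewrite yE => /(_ (Q_sym Qbc)) bE.
    by case: nbd; rewrite bE.
  move=> /upP[_ -> Qyc]; apply/upP; have [/Vcases + _] := Q_dom Qyc.
  case=> [yE|yE|[yE|yE|yE]]; rewrite yE in Qyc *.
  - by case: nac.
  - by exists b; [left; right|exact: Q_refl].
  - by exists d; [right|].
  - by exists d; [right|exact: Q_refl].
  - by case: nce; exact: Q_sym.
have loZa : lo Z a.
  apply: le1; apply/loP; split=> // y Qay; have [_ /Vcases] := Q_dom Qay.
  by case=> [->|->|[yE|yE|yE]]; [left|right|rewrite yE in Qay..].
have nZ y : Z y -> ~ Q (e, y).
  move=> Zy Qey; have /upP[w + Qew] := le3 _ ((upP Z e).2 (ex_intro2 _ _ y Zy Qey)).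
  by case=> [[]|] wE; rewrite wE in Qew; move: Qew => /Q_sym.
have Zc : Z c.
  have /upP[y Zy Qdy] : up Z d by apply: le2; apply/upP; exists c => //; exact: Q_sym.
  have [_ /Vcases] := Q_dom Qdy.
  case=> [yE|yE|[yE|yE|yE]]; rewrite yE in Zy Qdy => //.
  - by case: nad; exact: Q_sym.
  - by case: nbd; exact: Q_sym.
  - by case: (nZ _ Zy); exact: Q_sym.
  - by case: (nZ _ Zy); exact: Q_refl.
have [_ aZ] := (loP Z a).1 loZa.
have loZb : lo Z b.
  apply/loP; split=> // y Qby; have [_ /Vcases] := Q_dom Qby.
  case=> [->|->|[->|yE|yE]] //; last 2 first.
  - by rewrite yE in Qby.
  - by rewrite yE in Qby.
  - by apply: aZ; exact: Q_refl.
  - exact: aZ.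
have [_ /(_ c Qbc)] := (loP _ b).1 (le4 _ loZb).
case=> [[cE|cE]|cE].
- by case: nac; rewrite cE; exact: Q_refl.
- by case: nbd; rewrite -cE.
- by case: nce; rewrite cE.
Qed.

End RoughSetOrder.

(** * Induced paths under restriction *)

Section Restriction.
Variables (U : Type) (R : set (U * U)).
Hypothesis hR : tolerance_on [set: U] R.

Let R_refl x : R (x, x).
Proof. by have [_ + _] := hR; apply. Qed.

Let R_sym x y : R (x, y) -> R (y, x).
Proof. by have [_ _ +] := hR; apply. Qed.

Lemma restr_tolerance (X : set U) : tolerance_on X (restr R X).
Proof.
split=> [p []//|x Xx|x y [/R_sym Ryx [Xx Xy]]]; first by split.
by split.
Qed.

Lemma P5_free_restr (X : set U) : P5_free R -> P5_free (restr R X).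
Proof.
move=> noP5 a b c d e [[Qab Qbc Qcd Qde] [[nac nad nae] [nbd nbe nce]]].
case: Qab Qbc Qcd Qde => [Rab [Xa Xb]] [Rbc [_ Xc]] [Rcd [_ Xd]] [Rde [_ Xe]].
apply: (noP5 a b c d e); split; first by split.
by split; split=> Rxy; [apply: nac|apply: nad|apply: nae|apply: nbd|apply: nbe|apply: nce].
Qed.

Lemma restr_induced_P5 (X : set U) (a b c d e : U) :
  X = [set a; b; c; d; e] -> induced_P5 R a b c d e ->
  induced_P5 (restr R X) a b c d e.
Proof.
move=> XE [[Rab Rbc Rcd Rde] [[nac nad nae] [nbd nbe nce]]].
have Xa : X a by rewrite XE; do 4 left.
have Xb : X b by rewrite XE; do 3 left; right.
have Xc : X c by rewrite XE; do 2 left; right.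
have Xd : X d by rewrite XE; left; right.
have Xe : X e by rewrite XE; right.
by split; [split|split; split=> -[]].
Qed.

Lemma card_induced_P5 (a b c d e : U) :
  induced_P5 R a b c d e -> [set a; b; c; d; e] #= `I_5.
Proof.
move=> [[Rab Rbc Rcd Rde] [[nac nad nae] [nbd nbe nce]]].
pose f := nth a [:: a; b; c; d; e].
have -> : [set a; b; c; d; e] = f @` `I_5.
  apply/seteqP; split=> [y|_ [[|[|[|[|[|//]]]]] _ <-]] /=.
  - move=> [[[[]|]|]|] ->.
    + by exists 0.
    + by exists 1.
    + by exists 2.
    + by exists 3.
    + by exists 4.
  - by do 4 left.
  - by do 3 left; right.
  - by do 2 left; right.
  - by left; right.
  - by right.
apply: inj_card_eq => i j /set_mem + /set_mem.
(* Non-adjacent vertices differ by reflexivity; consecutive ones differ because some third vertex is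
   adjacent to only one of them. *)
have Rcc := R_refl c; have Rdd := R_refl d; have Ree := R_refl e.
have Rdc := R_sym Rcd; have Red := R_sym Rde.
case: i j => [|[|[|[|[|//]]]]] [|[|[|[|[|//]]]]] //= _ _; rewrite /f /=; congruence.
Qed.

End Restriction.

(** * Transitivity of the cube *)

Section Cube.
Variables (U : Type) (V : set U) (Q : set (U * U)).
Hypothesis hQ : tolerance_on V Q.

Lemma rel_cubeP (x y : U) :
  rel_cube Q (x, y) <-> exists u v, [/\ Q (x, u), Q (u, v) & Q (v, y)].
Proof.
split=> [[v [u Qxu Quv] Qvy]|[u [v [Qxu Quv Qvy]]]]; first by exists u, v.
by exists v => //; exists u.
Qed.

(** Any chord of the walk [x - u - v - y - z], padded with loops if necessary, yields a walk of
    length three from [x] to [z]; without such a walk the path is induced. *)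
Lemma P5_free_shortcut (x y z : U) :
  P5_free Q -> rel_cube Q (x, y) -> Q (y, z) -> rel_cube Q (x, z).
Proof.
move=> noP5 /rel_cubeP[u [v [Qxu Quv Qvy]]] Qyz; apply: contrapT => nxz.
have [QV Qr Qs] := hQ.
have [Vx Vu] := QV _ Qxu; have [Vv Vy] := QV _ Qvy; have [_ Vz] := QV _ Qyz.
have walk p q : Q (x, p) -> Q (p, q) -> ~ Q (q, z).
  by move=> Qxp Qpq Qqz; apply: nxz; apply/rel_cubeP; exists p, q.
apply: (noP5 x u v y z); split; first by split.
split; split=> Qpq.
- exact: (walk v y).
- by apply: (walk y y) => //; exact: Qr.
- by apply: (walk z z) => //; exact: Qr.
- exact: (walk u y).
- by apply: (walk u z) => //; exact: Qr.
- exact: (walk u v).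
Qed.

Lemma P5_free_equivalence : P5_free Q -> equivalence_on V (rel_cube Q).
Proof.
move=> noP5; have [QV Qr Qs] := hQ.
split=> [[x y] /rel_cubeP[u [v [/QV[Vx _] _ /QV[_ Vy]]]]|x Vx|x y|x y z].
- by split.
- by apply/rel_cubeP; exists x, x; split; exact: Qr.
- move=> /rel_cubeP[u [v [/Qs Qxu /Qs Quv /Qs Qvy]]].
  by apply/rel_cubeP; exists v, u.
- move=> Qxy /rel_cubeP[u [v [Qyu Quv Qvz]]].
  have cut := P5_free_shortcut noP5.
  (* The three edges from [y] to [z] are appended one at a time, shortening back to length three
     after each. *)
  exact: (cut _ _ _ (cut _ _ _ (cut _ _ _ Qxy Qyu) Quv) Qvz).
Qed.

Lemma induced_P5_not_equivalence (a b c d e : U) :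
  V = [set a; b; c; d; e] -> induced_P5 Q a b c d e ->
  ~ equivalence_on V (rel_cube Q).
Proof.
move=> VE [[Qab Qbc Qcd Qde] [[nac nad nae] [nbd nbe nce]]] [_ _ _ tr].
have [QV Qr Qs] := hQ; have [_ Ve] := QV _ Qde.
have Qad : rel_cube Q (a, d) by apply/rel_cubeP; exists b, c.
have Qde3 : rel_cube Q (d, e).
  by apply/rel_cubeP; exists e, e; split=> //; exact: Qr.
have /rel_cubeP[p [q [Qap Qpq Qqe]]] := tr _ _ _ Qad Qde3.
have Vp : V p := (QV _ Qap).2; have Vq : V q := (QV _ Qqe).1.
(* A walk [a - p - q - e] must cross from [{a, b}] to [{d, e}] in one edge, and there is none. *)
have pE : p = a \/ p = b.
  by move: Vp; rewrite VE => -[[[[]|]|]|] pE; rewrite pE in Qap; auto.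
have qE : q = d \/ q = e.
  by move: Vq; rewrite VE => -[[[[]|]|]|] qE; rewrite qE in Qqe; auto.
by case: pE qE Qpq => -> [] ->.
Qed.

End Cube.

Theorem corollary4p14 (U : Type) (R : set (U * U)) (hR : tolerance_on [set: U] R) :
  [<-> (* (a) *) forall X : set U, is_complete_lattice (RS X (restr R X));
       (* (b) *) forall X : set U, X #= `I_5 -> is_lattice (RS X (restr R X));
       (* (c) *) forall X : set U, equivalence_on X (rel_cube (restr R X))].
Proof.
have tol X := restr_tolerance hR X.
tfae.
- by move=> complete X _ x y; exact: complete.
- move=> lat X; apply: P5_free_equivalence (tol X) _.
  apply: P5_free_restr => a b c d e P5.
  (* The hypothesis is applied to the vertex set of the path, not to [X]. *)
  apply: (induced_P5_not_lattice (tol _) erefl (restr_induced_P5 erefl P5)).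
  by apply: lat; apply: (card_induced_P5 hR P5).
- move=> equiv X; apply: P5_free_complete (tol X) _.
  apply: P5_free_restr => a b c d e P5.
  exact: (induced_P5_not_equivalence (tol _) erefl (restr_induced_P5 erefl P5)).
Qed.
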